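(* Let $A, B \in M_n(\mathbb{H})$ be normal matrices. Let $\mu_1, \mu_2, \ldots, \mu_n$ and $\delta_1, \delta_2, \ldots, \delta_n$ be the standard eigenvalues of $A$ and $B$ respectively. Then there exists a permutation $\pi$ of $\{1, 2, \ldots, n\}$ such that $$\sum_{i=1}^{n} |\mu_i - \delta_{\pi(i)}|^2 \leq \|A-B\|_F^2 .$$
   Context: $\mathbb{H}$ is the set of real quaternions and $M_n(\mathbb{H})$ is the set of $n\times n$ matrices over $\mathbb{H}$. For $A=(a_{ij})\in M_n(\mathbb{H})$, $A^*=(\bar a_{ji})$ is the conjugate transpose, and $A$ is normal if $AA^*=A^*A$. The Frobenius norm is $\|A\|_F=(\operatorname{trace} A^*A)^{1/2}$, i.e. $\|A\|_F^2=\sum_{i,j}|a_{ij}|^2$. A quaternion $\lambda_0$ is a right eigenvalue of $A$ if $Ax=x\lambda_0$ for some nonzero $x\in\mathbb{H}^n$. Every $A\in M_n(\mathbb{H})$ has exactly $n$ (counted with multiplicity) right eigenvalues that are complex numbers with nonnegative imaginary part; these are called the standard eigenvalues of $A$. Multiplicities are as follows: write $A=A_1+A_2 j$ with $A_1,A_2\in M_n(\mathbb{C})$ and let $\chi_A=\begin{bmatrix}A_1&A_2\\-\overline{A_2}&\overline{A_1}\end{bmatrix}\in M_{2n}(\mathbb{C})$; then $\lambda_1,\dots,\lambda_n$ (with nonnegative imaginary parts) are the standard eigenvalues of $A$ exactly when the eigenvalues of $\chi_A$, counted with algebraic multiplicity, are $\lambda_1,\dots,\lambda_n,\bar\lambda_1,\dots,\bar\lambda_n$.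 *)

(* Defs.v *)
From HB Require Import structures.
From mathcomp Require Import all_boot all_order all_algebra all_fingroup.
From mathcomp Require Import complex reals.
From mathcomp Require Import ring.

Set Implicit Arguments.
Unset Strict Implicit.
Unset Printing Implicit Defensive.

Import Order.TTheory GRing.Theory Num.Theory.

Local Open Scope ring_scope.
Local Open Scope complex_scope.

(* Cayley-Dickson form: Quat z w stands for z + w j with z, w complex, i.e.
   Re z + (Im z) i + (Re w) j + (Im w) k. *)
Record quat (R : Type) : Type := Quat { qfst : R[i]; qsnd : R[i] }.

Definition pair_of_quat (R : Type) (q : quat R) := (qfst q, qsnd q).
Definition quat_of_pair (R : Type) (p : R[i] * R[i]) := Quat p.1 p.2.

Lemma pair_of_quatK (R : Type) : cancel (@pair_of_quat R) (@quat_of_pair R).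
Proof. by case. Qed.

HB.instance Definition _ (R : eqType) :=
  Equality.copy (quat R) (can_type (@pair_of_quatK R)).
HB.instance Definition _ (R : choiceType) :=
  Choice.copy (quat R) (can_type (@pair_of_quatK R)).

Section Quaternion.
Variable R : rcfType.
Implicit Types p q r : quat R.

Definition addq p q := Quat (qfst p + qfst q) (qsnd p + qsnd q).
Definition oppq q := Quat (- qfst q) (- qsnd q).

Fact addqA : associative addq.
Proof. by move=> p q r; congr Quat; rewrite addrA. Qed.
Fact addqC : commutative addq.
Proof. by move=> p q; congr Quat; rewrite addrC. Qed.
Fact add0q : left_id (Quat 0 0) addq.
Proof. by case=> z w; congr Quat; rewrite add0r. Qed.
Fact addNq : left_inverse (Quat 0 0) oppq addq.
Proof. by move=> q; congr Quat; rewrite addNr. Qed.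

HB.instance Definition _ :=
  GRing.isZmodule.Build (quat R) addqA addqC add0q addNq.

(* Determined by j ^ 2 = -1 and j z = (conjc z) j for z complex. *)
Definition mulq p q :=
  Quat (qfst p * qfst q - qsnd p * conjc (qsnd q))
       (qfst p * qsnd q + qsnd p * conjc (qfst q)).

Fact mulqA : associative mulq.
Proof.
move=> [a b] [c d] [e f]; rewrite /mulq /=.
by congr Quat; rewrite !(rmorphD, rmorphN, rmorphM, conjcK) /=;
  rewrite ?conjcK; ring.
Qed.
Fact mul1q : left_id (Quat 1 0) mulq.
Proof. by case=> z w; congr Quat; rewrite /= mul1r mul0r ?subr0 ?addr0. Qed.
Fact mulq1 : right_id (Quat 1 0) mulq.
Proof.
case=> z w; rewrite /mulq [qfst (Quat 1 0)]/= [qsnd (Quat 1 0)]/= conjc0 conjc1.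
by rewrite !(mulr0, mulr1) subr0 add0r.
Qed.
Fact mulqDl : left_distributive mulq addq.
Proof. by move=> [a b] [c d] [e f]; congr Quat => /=; ring. Qed.
Fact mulqDr : right_distributive mulq addq.
Proof.
by move=> [a b] [c d] [e f]; congr Quat => /=; rewrite !rmorphD /=; ring.
Qed.
Fact oneq_neq0 : Quat 1 0 != 0 :> quat R.
Proof. by apply/eqP=> -[/eqP]; rewrite oner_eq0. Qed.

HB.instance Definition _ :=
  GRing.Zmodule_isNzRing.Build (quat R)
    mulqA mul1q mulq1 mulqDl mulqDr oneq_neq0.

Definition complexq (z : R[i]) : quat R := Quat z 0.
Definition realq (a : R) : quat R := complexq a%:C.
Definition qi : quat R := complexq 'i.
Definition qj : quat R := Quat 0 1.
Definition qk : quat R := Quat 0 'i.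

Definition conjq q := Quat (conjc (qfst q)) (- qsnd q).
Definition sqnormq q : R :=
  complex.Re (qfst q) ^+ 2 + complex.Im (qfst q) ^+ 2 +
  complex.Re (qsnd q) ^+ 2 + complex.Im (qsnd q) ^+ 2.
Definition normq q : R := Num.sqrt (sqnormq q).

Lemma qii : qi * qi = -1.
Proof. by congr Quat => /=; simpc. Qed.
Lemma qjj : qj * qj = -1.
Proof. by congr Quat => /=; simpc. Qed.
Lemma qkk : qk * qk = -1.
Proof. by congr Quat => /=; simpc. Qed.
Lemma qij : qi * qj = qk.
Proof. by congr Quat => /=; simpc. Qed.
Lemma qijk : qi * qj * qk = -1.
Proof. by rewrite qij qkk. Qed.

Lemma mulq_complex q z : q * complexq z = Quat (qfst q * z) (qsnd q * conjc z).
Proof.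
rewrite /complexq; congr Quat; rewrite [qfst (Quat z 0)]/= [qsnd (Quat z 0)]/=.
  by rewrite conjc0 mulr0 subr0.
by rewrite mulr0 add0r.
Qed.

Lemma mulq_conj q : q * conjq q = realq (sqnormq q).
Proof.
case: q => [[a b] [c d]].
by rewrite /realq /complexq /sqnormq; congr Quat => /=; simpc;
  congr Complex; ring.
Qed.

Lemma conjq_mul q : conjq q * q = realq (sqnormq q).
Proof.
case: q => [[a b] [c d]].
by rewrite /realq /complexq /sqnormq; congr Quat => /=; simpc;
  congr Complex; ring.
Qed.

Lemma sqnormq_ge0 q : 0 <= sqnormq q.
Proof. by rewrite /sqnormq !addr_ge0 ?sqr_ge0. Qed.

Fact qfst_is_zmod_morphism : zmod_morphism (@qfst R).
Proof. by []. Qed.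
Fact qsnd_is_zmod_morphism : zmod_morphism (@qsnd R).
Proof. by []. Qed.
Fact realq_is_zmod_morphism : zmod_morphism realq.
Proof. by move=> a b; rewrite /realq rmorphB /=; congr Quat; rewrite subrr. Qed.
HB.instance Definition _ :=
  GRing.isZmodMorphism.Build (quat R) R[i] (@qfst R) qfst_is_zmod_morphism.
HB.instance Definition _ :=
  GRing.isZmodMorphism.Build (quat R) R[i] (@qsnd R) qsnd_is_zmod_morphism.
HB.instance Definition _ :=
  GRing.isZmodMorphism.Build R (quat R) realq realq_is_zmod_morphism.
End Quaternion.

Section QuaternionMatrix.
Variable R : rcfType.

Definition adjmx (m n : nat) (A : 'M[quat R]_(m, n)) : 'M[quat R]_(n, m) :=
  (map_mx (@conjq R) A)^T.

Definition normal_qmx (n : nat) (A : 'M[quat R]_n) : Prop :=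
  A *m adjmx A = adjmx A *m A.

Definition frobenius (m n : nat) (A : 'M[quat R]_(m, n)) : R :=
  Num.sqrt (\sum_i \sum_j normq (A i j) ^+ 2).

(* For A = A1 + A2 j this is [A1, A2; - conj A2, conj A1]. *)
Definition complex_adjoint (n : nat) (A : 'M[quat R]_n) : 'M[R[i]]_(n + n) :=
  let A1 := map_mx (@qfst R) A in
  let A2 := map_mx (@qsnd R) A in
  block_mx A1 A2 (- map_mx conjc A2) (map_mx conjc A1).

Definition right_eigenvalue (n : nat) (A : 'M[quat R]_n) (l : quat R) : Prop :=
  exists2 x : 'cV[quat R]_n, x != 0 & A *m x = x *m l%:M.

(* The list mu is the multiset of standard eigenvalues: these are taken with
   multiplicity, which is read off the characteristic polynomial of the complex
   adjoint. That the underlying set is the set of complex right eigenvalues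
   with nonnegative imaginary part is standard_eigenvaluesP below. *)
Definition standard_eigenvalues (n : nat) (A : 'M[quat R]_n)
    (mu : 'I_n -> R[i]) : Prop :=
  (forall i, 0 <= complex.Im (mu i)) /\
  char_poly (complex_adjoint A) =
    \prod_i (('X - (mu i)%:P) * ('X - (conjc (mu i))%:P)).

Lemma frobenius_trace (m n : nat) (A : 'M[quat R]_(m, n)) :
  \tr (adjmx A *m A) = realq (frobenius A ^+ 2).
Proof.
rewrite sqr_sqrtr; last by do 2!apply: sumr_ge0 => ? _; exact: sqr_ge0.
rewrite /mxtrace exchange_big /= raddf_sum; apply: eq_bigr => j _.
rewrite mxE raddf_sum; apply: eq_bigr => i _.
by rewrite !mxE conjq_mul sqr_sqrtr ?sqnormq_ge0.
Qed.

Lemma root_char_poly_col (F : fieldType) (n : nat) (M : 'M[F]_n) (l : F) :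
  root (char_poly M) l <-> exists2 y : 'cV_n, y != 0 & M *m y = l *: y.
Proof.
have -> : char_poly M = char_poly M^T.
  by rewrite /char_poly -det_tr /char_poly_mx linearB /= tr_scalar_mx map_trmx.
rewrite -eigenvalue_root_char; split=> [/eigenvalueP[v vM v0]|[y y0 My]].
  exists v^T; first by rewrite trmx_eq0.
  by rewrite -[M]trmxK -trmx_mul vM linearZ.
apply/eigenvalueP; exists y^T; last by rewrite trmx_eq0.
by rewrite -trmx_mul My linearZ.
Qed.

Lemma right_eigenvalue_char_poly (n : nat) (A : 'M[quat R]_n) (l : R[i]) :
  right_eigenvalue A (complexq l) <-> root (char_poly (complex_adjoint A)) l.
Proof.
rewrite root_char_poly_col.
pose enc (x : 'cV[quat R]_n) : 'cV[R[i]]_(n + n) :=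
  col_mx (map_mx (@qfst R) x) (- map_mx conjc (map_mx (@qsnd R) x)).
pose dec (y : 'cV[R[i]]_(n + n)) : 'cV[quat R]_n :=
  \col_i Quat (usubmx y i 0) (- conjc (dsubmx y i 0)).
have encK : cancel enc dec.
  move=> x; apply/colP => i; rewrite mxE col_mxKu col_mxKd !mxE.
  by rewrite rmorphN /= conjcK opprK; case: (x i 0).
have decK : cancel dec enc.
  move=> y; rewrite -[RHS]vsubmxK; congr col_mx; apply/colP => i.
    by rewrite !mxE.
  by rewrite !mxE /= rmorphN /= conjcK opprK.
have enc0 : enc 0 = 0 by rewrite /enc !map_mx0 oppr0 col_mx0.
have enc_mul x : complex_adjoint A *m enc x = enc (A *m x).
  rewrite /complex_adjoint /enc mul_block_col; congr col_mx; apply/colP => i.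
    rewrite !mxE (raddf_sum (@qfst R)) -big_split /=; apply: eq_bigr => k _.
    by rewrite !mxE mulrN.
  rewrite !mxE (raddf_sum (@qsnd R)) rmorph_sum /= -sumrN -big_split /=.
  apply: eq_bigr => k _; rewrite !mxE rmorphD !rmorphM /= conjcK.
  by rewrite mulNr mulrN opprD addrC.
have enc_scale x : enc (x *m (complexq l)%:M) = l *: enc x.
  rewrite scale_col_mx; congr col_mx; apply/colP => i;
    rewrite !mxE big_ord1 !mxE mulr1n.
    by rewrite mulq_complex /= mulrC.
  by rewrite mulq_complex /= rmorphM /= conjcK mulrN mulrC.
split=> [[x x0 Ax]|[y y0 My]].
  exists (enc x); last by rewrite enc_mul Ax enc_scale.
  by rewrite -enc0 (can_eq encK).
exists (dec y); first by rewrite -(can_eq encK) enc0 decK.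
by apply: (can_inj encK); rewrite -enc_mul enc_scale decK.
Qed.

Lemma standard_eigenvaluesP (n : nat) (A : 'M[quat R]_n) (mu : 'I_n -> R[i]) :
    standard_eigenvalues A mu ->
  forall l : R[i], 0 <= complex.Im l ->
    right_eigenvalue A (complexq l) <-> exists i, l = mu i.
Proof.
move=> [mu_ge0 chiA] l l_ge0.
rewrite right_eigenvalue_char_poly chiA rootE horner_prod.
split=> [/eqP/eqP|[i ->]]; last first.
  by rewrite (bigD1 i) //= hornerM !hornerXsubC subrr !mul0r.
rewrite prodf_seq_eq0 => /hasP[i _ /=].
rewrite hornerM !hornerXsubC mulf_eq0 !subr_eq0 => /orP[/eqP->|/eqP le].
  by exists i.
exists i; have := mu_ge0 i; move: l_ge0; rewrite le.
case: (mu i) => a b /=; rewrite oppr_ge0 => b_le0 b_ge0.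
have /eqP-> : b == 0 by rewrite eq_le b_ge0 b_le0.
by rewrite oppr0.
Qed.
End QuaternionMatrix.

(* Main.v *)
(* For A normal, the 2n x 2n complex adjoint of A is normal, with
   eigenvalues mu_i and conj mu_i; diagonalize those of A and B by unitaries
   and let W be the transition unitary. Then 2 |A - B|_F^2 is the sum of |W
   k l|^2 |a_k - b_l|^2, with ( |W k l|^2 ) doubly stochastic. Since all
   imaginary parts of mu and delta are nonnegative, conjugating only one of
   mu_i, delta_j does not bring them closer, so the four entries of that
   matrix attached to (i, j) may be averaged into one entry of an n x n
   doubly stochastic matrix. A Birkhoff-type argument then provides a
   permutation whose cost is at most the average cost. *)

Require Import Defs.
From mathcomp Require Import all_boot all_order all_algebra all_fingroup.
From mathcomp Require Import complex reals spectral.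
From mathcomp Require Import ring lra.

Import Order.TTheory GRing.Theory Num.Theory.

Local Open Scope ring_scope.
Local Open Scope complex_scope.

(** * Doubly stochastic matrices and optimal assignments *)

Definition doubly_stochastic {R : numDomainType} {n : nat} (S : 'M[R]_n) :=
  [/\ forall i j, 0 <= S i j, forall i, \sum_j S i j = 1
    & forall j, \sum_i S i j = 1].

(* The 2n row and column sum functionals are linearly dependent (total sum by
   rows = total sum by columns), so they have rank less than 2n <= #|E|. *)
Lemma zero_sum_matrix_on {F : fieldType} {n : nat} (E : {set 'I_n * 'I_n}) :
    (0 < n)%N -> (n + n <= #|E|)%N ->
  exists D : 'M[F]_n, [/\ D != 0, forall i j, (i, j) \notin E -> D i j = 0,
    forall i, \sum_j D i j = 0 & forall j, \sum_i D i j = 0].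
Proof.
move=> n_gt0 leE.
(* Row [e] of [M] marks the row and the column of the [e]-th position of [E], so a vector of the
   left kernel lists the entries of a matrix on [E] with zero line sums. The vector [w] records the
   dependence between the two kinds of sums. *)
pose M : 'M[F]_(#|E|, n + n) := \matrix_(e < #|E|)
  row_mx (delta_mx 0 (enum_val e).1) (delta_mx 0 (enum_val e).2).
pose w : 'cV[F]_(n + n) := col_mx (const_mx 1) (const_mx (-1)).
have deltaC (k : 'I_n) (c : F) : delta_mx 0 k *m const_mx c = c%:M :> 'M_1.
  rewrite -rowE; apply/rowP=> i.
  by rewrite !mxE (ord1 i).
have Mw : M *m w = 0.
  apply/row_matrixP=> e; rewrite row_mul rowK mul_row_col !deltaC row0.
  by rewrite -raddfD /= subrr raddf0.
(* Independent rows would give rank [#|E|], hence full column rank, contradicting [M *m w = 0]; [w]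
   is nonzero because [0 < n]. *)
have Mnfree : ~~ row_free M.
  apply/negP=> /eqP rkM.
  have /row_full_inj Minj : row_full M.
    by rewrite /row_full eqn_leq rank_leq_col rkM.
  have /(congr1 (fun A => usubmx A (Ordinal n_gt0) 0)) : w = 0.
    by apply: Minj; rewrite Mw mulmx0.
  by rewrite col_mxKu !mxE => /eqP; rewrite oner_eq0.
have [v vM v0] : exists2 v : 'rV_#|E|, v *m M = 0 & v != 0.
  have /rowV0Pn[v /sub_kermxP vM v0] : kermx M != 0 by rewrite kermx_eq0.
  by exists v.
have vMu k : \sum_e v 0 e * ((enum_val e).1 == k)%:R = 0.
  have /rowP/(_ (lshift n k)) := vM; rewrite mxE [in RHS]mxE => vMk.
  rewrite -[RHS]vMk; apply: eq_bigr => e _.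
  by rewrite mxE row_mxEl mxE eqxx eq_sym.
have vMd k : \sum_e v 0 e * ((enum_val e).2 == k)%:R = 0.
  have /rowP/(_ (rshift n k)) := vM; rewrite mxE [in RHS]mxE => vMk.
  rewrite -[RHS]vMk; apply: eq_bigr => e _.
  by rewrite mxE row_mxEr mxE eqxx eq_sym.
pose D : 'M[F]_n := \matrix_(i, j) \sum_e v 0 e * (enum_val e == (i, j))%:R.
exists D; split.
- have [e ve] := rV0Pn _ v0; apply: contra_neq ve => /matrixP.
  move=> /(_ (enum_val e).1 (enum_val e).2); rewrite !mxE -surjective_pairing.
  rewrite (bigD1 e) //= eqxx mulr1 big1 ?addr0 // => f fe.
  by rewrite (inj_eq enum_val_inj) (negPf fe) mulr0.
- move=> i j; apply: contraNeq; rewrite mxE; apply: contraR => ijE.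
  apply/eqP; apply: big1 => e _.
  by case: eqP ijE => [<-|_]; rewrite ?enum_valP ?mulr0.
- move=> i; under eq_bigr do rewrite mxE.
  rewrite -[RHS](vMu i) exchange_big /=.
  apply: eq_bigr => e _; case: (enum_val e) => a b /=; rewrite -mulr_sumr.
  rewrite (bigD1 b) //= xpair_eqE eqxx andbT big1 ?addr0 // => j jb.
  by rewrite xpair_eqE [b == j]eq_sym (negPf jb) andbF.
- move=> j; under eq_bigr do rewrite mxE.
  rewrite -[RHS](vMd j) exchange_big /=.
  apply: eq_bigr => e _; case: (enum_val e) => a b /=; rewrite -mulr_sumr.
  rewrite (bigD1 a) //= xpair_eqE eqxx big1 ?addr0 // => i ia.
  by rewrite xpair_eqE [a == i]eq_sym (negPf ia).
Qed.

Definition support_mx {R : nmodType} {n : nat} (S : 'M[R]_n) :=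
  [set e : 'I_n * 'I_n | S e.1 e.2 != 0].

(** Two nonzero entries per row make the support large enough to carry a nonzero direction [D] with
    zero line sums. Up to sign, [D] does not raise the linear cost, and moving along it until an
    entry of [S] vanishes shrinks the support. *)
Lemma doubly_stochastic_perturb {R : realFieldType} {n : nat} (S c : 'M[R]_n) :
    (0 < n)%N -> doubly_stochastic S ->
    (forall i, 1 < #|[set j | S i j != 0%R]|)%N ->
  exists T : 'M[R]_n, [/\ doubly_stochastic T,
    (#|support_mx T| < #|support_mx S|)%N
    & \sum_i \sum_j T i j * c i j <= \sum_i \sum_j S i j * c i j].
Proof.
move=> n_gt0 [S0 Sr Sc] S2.
have leE : (n + n <= #|support_mx S|)%N.
  have -> : #|support_mx S| = (\sum_i #|[set j | S i j != 0%R]|)%N.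
    rewrite -sum1_card (eq_bigl (fun e => S e.1 e.2 != 0)); last first.
      by move=> e; rewrite inE.
    rewrite -(pair_big_dep xpredT (fun i j => S i j != 0) (fun _ _ => 1%N)) /=.
    by apply: eq_bigr => i _; rewrite sum1dep_card.
  rewrite addnn -muln2 -[X in (X * _)%N]card_ord.
  by rewrite -sum_nat_const; apply: leq_sum => i _.
have [D [D0 Dsupp Dr Dc cD]] : exists D : 'M[R]_n, [/\ D != 0,
    forall i j, S i j = 0 -> D i j = 0, forall i, \sum_j D i j = 0,
    forall j, \sum_i D i j = 0 & \sum_i \sum_j D i j * c i j <= 0].
  have [D [D0 Dsupp Dr Dc]] := @zero_sum_matrix_on R n _ n_gt0 leE.
  have {}Dsupp i j : S i j = 0 -> D i j = 0.
    by move=> Sij; apply: Dsupp; rewrite inE Sij eqxx.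
  have [cD|cD] := leP (\sum_i \sum_j D i j * c i j) 0; first by exists D.
  exists (- D); split.
  - by rewrite oppr_eq0.
  - by move=> i j /Dsupp; rewrite mxE => ->; rewrite oppr0.
  - by move=> i; under eq_bigr do rewrite mxE; rewrite sumrN Dr oppr0.
  - by move=> j; under eq_bigr do rewrite mxE; rewrite sumrN Dc oppr0.
  - rewrite -oppr_ge0 -sumrN; apply: le_trans (ltW cD) _.
    by apply: ler_sum => i _; rewrite -sumrN; apply: ler_sum => j _;
       rewrite mxE mulNr opprK.
(* Since its row sums to 0, a positive entry of [D] forces a negative one beside it. *)
have [e0 De0] : exists e : 'I_n * 'I_n, D e.1 e.2 < 0.
  have [i [j Dij]] : exists i j, D i j != 0.
    by apply/matrix0Pn.
  have [Dneg|Dpos|/eqP] := ltgtP (D i j) 0; last by rewrite (negPf Dij).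
    by exists (i, j).
  have /existsP[k Dk] : [exists k, D i k < 0].
    apply: contraLR Dpos; rewrite negb_exists => /forallP Dk.
    rewrite -leNgt -(Dr i) (bigD1 j) //= lerDl sumr_ge0 // => k _.
    by rewrite leNgt.
  by exists (i, k).
(* [r e] is the step length at which entry [e] reaches 0; its minimum [t] over the negative entries
   of [D] is the longest step keeping [S + t *: D] nonnegative, and it kills entry [(a, b)]. *)
pose r (e : 'I_n * 'I_n) := S e.1 e.2 / - D e.1 e.2.
case: (@arg_minP _ _ _ e0 (fun e => D e.1 e.2 < 0) r De0) => -[a b] /= Dab rmin.
pose t := r (a, b).
have t0 : 0 <= t by rewrite divr_ge0 // oppr_ge0 ltW.
exists (S + t *: D); split; first split.
- move=> i j; rewrite !mxE.
  have [D0ij|Dij] := leP 0 (D i j); first by rewrite addr_ge0 // mulr_ge0.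
  have := rmin (i, j) Dij; rewrite -/t /r /= ler_pdivlMr ?oppr_gt0 //.
  by rewrite mulrN -subr_ge0 opprK.
- move=> i; under eq_bigr do rewrite !mxE.
  by rewrite big_split /= -mulr_sumr Sr Dr mulr0 addr0.
- move=> j; under eq_bigr do rewrite !mxE.
  by rewrite big_split /= -mulr_sumr Sc Dc mulr0 addr0.
- apply: proper_card; apply/properP; split.
    apply/subsetP=> -[i j]; rewrite !inE !mxE /=.
    by apply: contraNneq => Sij; rewrite Sij Dsupp // mulr0 addr0.
  exists (a, b); rewrite !inE /= ?mxE.
    by apply: contraTneq Dab => /Dsupp ->; rewrite ltxx.
  rewrite negbK /t /r /= invrN mulrN mulNr divfK ?subrr //.
  by rewrite lt_eqF.
- under eq_bigr do under eq_bigr do rewrite !mxE mulrDl -mulrA.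
  under eq_bigr do rewrite big_split /= -mulr_sumr.
  by rewrite big_split /= -mulr_sumr gerDl mulr_ge0_le0.
Qed.

(* If every row has two nonzero entries, perturbing shrinks the support without
   raising the cost; otherwise some row is a unit vector and is split off
   together with its column. *)
Lemma doubly_stochastic_assignment {R : realFieldType} {n : nat}
    (S c : 'M[R]_n) : doubly_stochastic S ->
  exists p : 'S_n, \sum_i c i (p i) <= \sum_i \sum_j S i j * c i j.
Proof.
elim: n S c => [|n IHn] S c.
  by exists 1%g; rewrite !big_ord0.
(* Inner induction on the size of the support, at fixed dimension. *)
have [m] := ubnP #|support_mx S|; elim: m S => // m IHm S Sm dsS.
have [/forallP S2|] := boolP [forall i, 1 < #|[set j | S i j != 0%R]|]%N.
  have [T [dsT Tm cT]] := doubly_stochastic_perturb S c (ltn0Sn n) dsS S2.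
  have [|p cp] := IHm T _ dsT; first exact: leq_trans Tm _.
  by exists p; apply: le_trans cp cT.
rewrite negb_forall => /existsP[a]; rewrite -leqNgt => S1.
have [S0 Sr Sc] := dsS.
have [b Sb] : exists b, forall j, j != b -> S a j = 0.
  have [b Sab] : exists b, S a b != 0.
    apply/existsP; apply: contra_eqT (Sr a); rewrite negb_exists => /forallP Sa.
    rewrite big1 ?[0 == 1]eq_sym ?oner_neq0 // => j _; apply/eqP.
    by have := Sa j; rewrite negbK.
  exists b => j jb; apply/eqP; apply: contraLR S1 => Saj; rewrite -ltnNge.
  apply: leq_trans (subset_leq_card (_ : [set j; b] \subset _)).
    by rewrite cards2 jb.
  by apply/subsetP=> k; rewrite !inE => /orP[]/eqP->.
have Sab : S a b = 1 by rewrite -(Sr a) (bigD1 b) //= big1 ?addr0.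
(* Column [b] sums to 1 and already contains a 1, so its other entries vanish. Deleting row [a] and
   column [b] therefore leaves a doubly stochastic matrix. *)
have Sa0 i : i != a -> S i b = 0.
  move=> ia; have := Sc b; rewrite (bigD1 a) //= Sab => /eqP.
  rewrite -[X in _ == X]addr0 (inj_eq (addrI 1)) psumr_eq0 // => /allP/(_ i).
  by rewrite mem_index_enum ia => /(_ isT)/eqP.
pose c' := \matrix_(i, j) c (lift a i) (lift b j).
have [|p cp] := IHn (\matrix_(i, j) S (lift a i) (lift b j)) c'.
  split=> [i j|i|j]; first by rewrite mxE.
  - under eq_bigr do rewrite mxE.
    by rewrite -(Sr (lift a i)) (bigD1_ord b) //= Sa0 ?add0r // eq_sym neq_lift.
  - under eq_bigr do rewrite mxE.
    by rewrite -(Sc (lift b j)) (bigD1_ord a) //= Sb ?add0r // eq_sym neq_lift.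
exists (lift_perm a b p).
rewrite (bigD1_ord a) //= lift_perm_id [leRHS](bigD1_ord a) //=.
have -> : \sum_j S a j * c a j = c a b.
  rewrite (bigD1 b) //= Sab mul1r big1 ?addr0 // => j jb.
  by rewrite Sb ?mul0r.
rewrite lerD2l (eq_bigr (fun i => c' i (p i))); last first.
  by move=> i _; rewrite lift_perm_lift mxE.
apply: le_trans cp _.
apply: ler_sum => i _; rewrite [leRHS](bigD1_ord b) //= Sa0 ?mul0r ?add0r.
  by apply: ler_sum => j _; rewrite !mxE.
by rewrite eq_sym neq_lift.
Qed.

(** * Unitary diagonalization and distance of normal complex matrices *)

Lemma char_poly_conj {R : comUnitRingType} {n : nat} (U M : 'M[R]_n) :
  U \in unitmx -> char_poly (invmx U *m M *m U) = char_poly M.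
Proof.
move=> Uu; pose U' := map_mx polyC U; pose V' := map_mx polyC (invmx U).
have V'U' : V' *m U' = 1%:M by rewrite -map_mxM mulVmx // map_mx1.
have conj_mx : char_poly_mx (invmx U *m M *m U) = V' *m char_poly_mx M *m U'.
  rewrite /char_poly_mx !map_mxM mulmxBr mulmxBl; congr (_ - _).
  by rewrite mul_mx_scalar -scalemxAl V'U' scalemx1.
by rewrite /char_poly conj_mx !det_mulmx mulrAC -det_mulmx V'U' det1 mul1r.
Qed.

Section NormalMatrices.
Local Open Scope sesquilinear_scope.
Context {C : numClosedFieldType}.

Lemma trace_mul_adjoint {m n : nat} (X : 'M[C]_(m, n)) :
  \tr (X *m X^t*) = \sum_i \sum_j `|X i j| ^+ 2.
Proof.
apply: eq_bigr => i _; rewrite mxE; apply: eq_bigr => j _.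
by rewrite !mxE normCK.
Qed.

Lemma unitarymx_row_sum {n : nat} (W : 'M[C]_n) (i : 'I_n) :
  W \is unitarymx -> \sum_j `|W i j| ^+ 2 = 1.
Proof.
move=> /unitarymxP/matrixP/(_ i i); rewrite mxE [RHS]mxE eqxx mulr1n => <-.
by apply: eq_bigr => j _; rewrite !mxE normCK.
Qed.

Lemma unitarymx_col_sum {n : nat} (W : 'M[C]_n) (j : 'I_n) :
  W \is unitarymx -> \sum_i `|W i j| ^+ 2 = 1.
Proof.
rewrite -trmx_unitary => /(unitarymx_row_sum _ j) <-.
by apply: eq_bigr => i _; rewrite mxE.
Qed.

(** The spectral theorem yields the eigenvalues in an uncontrolled order. Unique factorization of
    the characteristic polynomial matches them with [l] up to a permutation, which is absorbed into
    the unitary factor. *)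
Lemma normalmx_diagonalization {n : nat} (N : 'M[C]_n) (l : 'I_n -> C) :
    N \is normalmx -> char_poly N = \prod_i ('X - (l i)%:P) ->
  exists2 U : 'M[C]_n, U \is unitarymx & N = U^t* *m diag_mx (\row_i l i) *m U.
Proof.
move=> /orthomx_spectralP NE charN.
set S := spectralmx N in NE; set d := spectral_diag N in NE.
have Su : S \is unitarymx by apply: spectral_unitarymx.
have Sunit := unitarymx_unit Su.
have chard : char_poly N = \prod_i ('X - (d 0 i)%:P).
  have -> : char_poly N = char_poly (diag_mx d).
    by rewrite NE char_poly_conj.
  rewrite char_poly_trig; last by apply: diag_mx_is_trig.
  by apply: eq_bigr => i _; rewrite mxE eqxx.
have [p dp] : exists p : 'S_n, forall i, d 0 i = l (p i).
  have : perm_eq [tuple d 0 i | i < n] [tuple l i | i < n].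
    apply/prod_XsubC_eq.
    by rewrite !big_map -!enumT !big_enum /= -chard.
  move=> /tuple_permP[p /val_inj E]; exists p => i.
  by have := congr1 (fun t => tnth t i) E; rewrite !tnth_mktuple.
(* Row [i] is the eigenvector of index [p^-1 i], whose eigenvalue is [l i]. *)
exists (row_perm p^-1 S).
  rewrite row_permE mul_unitarymx //; apply/unitarymxP.
  by rewrite tr_perm_mx map_perm_mx invgK -perm_mxM mulVg perm_mx1.
rewrite NE invmx_unitary //; apply/matrixP => i j; rewrite !mul_mx_diag !mxE.
rewrite [RHS](reindex_inj (@perm_inj _ p)); apply: eq_bigr => k _.
by rewrite !mxE permK dp.
Qed.

(** The Frobenius norm is unitarily invariant, and with [W = U *m V^t*] the matrix
    [U *m (N - M) *m V^t*] has entries [(d i - e j) * W i j]. *)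
Lemma normal_distance {n : nat} (N M U V : 'M[C]_n) (d e : 'I_n -> C) :
    U \is unitarymx -> V \is unitarymx ->
    N = U^t* *m diag_mx (\row_i d i) *m U ->
    M = V^t* *m diag_mx (\row_i e i) *m V ->
  \sum_i \sum_j `|(N - M) i j| ^+ 2 =
  \sum_i \sum_j `|(U *m V^t*) i j| ^+ 2 * `|d i - e j| ^+ 2.
Proof.
move=> Uu Vu NE ME; set W := U *m V^t*.
have trU (X : 'M[C]_n) : U^t* *m U *m X = X.
  by rewrite -invmx_unitary // mulVmx ?unitarymx_unit // mul1mx.
have trV (X : 'M[C]_n) : X *m V^t* *m V = X.
  by rewrite -invmx_unitary // mulmxKV // unitarymx_unit.
have WE : U *m (N - M) *m V^t* =
    diag_mx (\row_i d i) *m W - W *m diag_mx (\row_i e i).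
  rewrite NE ME mulmxBr mulmxBl !mulmxA mulmxtVK // (unitarymxP _) // mul1mx.
  by rewrite -mulmxA.
rewrite -trace_mul_adjoint.
have -> : \tr ((N - M) *m (N - M)^t*) =
    \tr ((U *m (N - M) *m V^t*) *m (U *m (N - M) *m V^t*)^t*).
  rewrite !trmx_mul !map_mxM /= !mulmxA trmxCK trV.
  by rewrite [RHS]mxtrace_mulC !mulmxA trU.
rewrite WE trace_mul_adjoint; apply: eq_bigr => i _; apply: eq_bigr => j _.
rewrite mul_diag_mx mul_mx_diag !mxE -exprMn -normrM.
by congr (`|_| ^+ 2); ring.
Qed.

End NormalMatrices.

(** * The complex adjoint as a homomorphism compatible with conjugate transposition *)

Section ComplexAdjoint.
Local Open Scope sesquilinear_scope.
Context {R : rcfType}.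

Lemma complex_adjointB {n : nat} (A B : 'M[quat R]_n) :
  complex_adjoint (A - B) = complex_adjoint A - complex_adjoint B.
Proof.
rewrite /complex_adjoint opp_block_mx add_block_mx !map_mxB /=.
by congr block_mx; rewrite opprB opprK addrC.
Qed.

Lemma complex_adjointM {n : nat} (A B : 'M[quat R]_n) :
  complex_adjoint (A *m B) = complex_adjoint A *m complex_adjoint B.
Proof.
rewrite /complex_adjoint mulmx_block.
congr block_mx; apply/matrixP => i j;
  rewrite !mxE ?raddf_sum ?rmorph_sum -?sumrN -big_split /=;
  apply: eq_bigr => k _; rewrite !mxE /=;
  by rewrite ?(rmorphD, rmorphN, rmorphM) /= ?conjcK; ring.
Qed.

Lemma complex_adjoint_adj {n : nat} (A : 'M[quat R]_n) :
  complex_adjoint (adjmx A) = (complex_adjoint A)^t*.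
Proof.
rewrite /complex_adjoint tr_block_mx map_block_mx.
congr block_mx; apply/matrixP => i j; rewrite !mxE //= ?rmorphN /= ?opprK //.
by congr (- _); rewrite -[LHS]conjcK.
Qed.

Lemma normal_complex_adjoint {n : nat} (A : 'M[quat R]_n) :
  normal_qmx A -> complex_adjoint A \is normalmx.
Proof.
move=> nA; apply/normalmxP.
by rewrite -complex_adjoint_adj -!complex_adjointM nA.
Qed.

(** An entry [z + w j] contributes [|z|^2 + |w|^2] twice: once in the upper blocks and once,
    conjugated, in the lower ones. *)
Lemma frobenius_complex_adjoint {n : nat} (A : 'M[quat R]_n) :
  \sum_i \sum_j `|complex_adjoint A i j| ^+ 2 = (frobenius A ^+ 2 *+ 2)%:C.
Proof.
rewrite sqr_sqrtr; last by do 2!apply: sumr_ge0 => ? _; exact: sqr_ge0.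
rewrite big_split_ord /= mulr2n rmorphD /= rmorph_sum.
congr (_ + _); apply: eq_bigr => i _; rewrite big_split_ord /= rmorph_sum;
  rewrite -big_split; apply: eq_bigr => j _; rewrite sqr_sqrtr ?sqnormq_ge0 //=;
  rewrite /sqnormq -addrA [RHS]rmorphD /= !add_Re2_Im2 /complex_adjoint.
  by rewrite block_mxEul block_mxEur !mxE.
by rewrite block_mxEdl block_mxEdr !mxE normrN !normcJ addrC.
Qed.
End ComplexAdjoint.

(** * Folding conjugate pairs of eigenvalues *)

Section StandardSpectrum.
Context {R : rcfType} {n : nat}.
Implicit Types mu delta : 'I_n -> R[i].

Definition conj_closure mu (k : 'I_(n + n)) : R[i] :=
  match split k with inl i => mu i | inr i => conjc (mu i) end.

Lemma conj_closure_lshift mu i : conj_closure mu (lshift n i) = mu i.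
Proof. by rewrite /conj_closure (unsplitK (inl i)). Qed.

Lemma conj_closure_rshift mu i : conj_closure mu (rshift n i) = conjc (mu i).
Proof. by rewrite /conj_closure (unsplitK (inr i)). Qed.

Lemma standard_char_poly (A : 'M[quat R]_n) mu : standard_eigenvalues A mu ->
  char_poly (complex_adjoint A) = \prod_k ('X - (conj_closure mu k)%:P).
Proof.
case=> _ ->; rewrite big_split_ord /= -big_split /=; apply: eq_bigr => i _.
by rewrite conj_closure_lshift conj_closure_rshift.
Qed.

(** Squared distance valued in [R] rather than [R[i]], so that costs live in a totally ordered
    field. *)
Definition sqdist (x y : R[i]) : R :=
  (complex.Re x - complex.Re y) ^+ 2 + (complex.Im x - complex.Im y) ^+ 2.

Lemma sqdistE x y : (sqdist x y)%:C = `|x - y| ^+ 2.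
Proof. by rewrite -add_Re2_Im2; case: x y => [a b] [c d]. Qed.

Lemma sqdist_conj x y : sqdist (conjc x) (conjc y) = sqdist x y.
Proof. by case: x y => [a b] [c d]; rewrite /sqdist /=; ring. Qed.

(** Conjugating one argument adds four times the product of the imaginary parts. *)
Lemma sqdist_conj_le x y : 0 <= complex.Im x -> 0 <= complex.Im y ->
  sqdist x y <= sqdist x (conjc y) /\ sqdist x y <= sqdist (conjc x) y.
Proof.
by case: x y => [a b] [c d]; rewrite /sqdist /= => b0 d0; split; nra.
Qed.

(* Indices k and n + k stand for mu_k and conj mu_k, hence are merged. *)
Definition fold_block (P : 'M[R]_(n + n)) : 'M[R]_n :=
  2^-1 *: (ulsubmx P + ursubmx P + dlsubmx P + drsubmx P).

(** Row [i] of the fold sums to the mean of the sums of rows [i] and [n + i] of [P]; likewise for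
    columns. *)
Lemma doubly_stochastic_fold (P : 'M[R]_(n + n)) :
  doubly_stochastic P -> doubly_stochastic (fold_block P).
Proof.
move=> [P0 Pr Pc]; split=> [i j|i|j].
- by rewrite !mxE mulr_ge0 ?invr_ge0 ?ler0n // !addr_ge0.
- under eq_bigr do rewrite !mxE.
  have := Pr (lshift n i); have := Pr (rshift n i).
  by rewrite -mulr_sumr !big_split_ord !big_split /=; lra.
- under eq_bigr do rewrite !mxE.
  have := Pc (lshift n j); have := Pc (rshift n j).
  by rewrite -mulr_sumr !big_split_ord !big_split /=; lra.
Qed.

(** For each [(i, j)], the two diagonal blocks are charged exactly [sqdist (mu i) (delta j)] and the
    two off-diagonal blocks at least that; the factor 2 cancels the [2^-1] of the fold. *)
Lemma fold_block_cost (P : 'M[R]_(n + n)) mu delta :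
    (forall k l, 0 <= P k l) ->
    (forall i, 0 <= complex.Im (mu i)) ->
    (forall i, 0 <= complex.Im (delta i)) ->
  2 * (\sum_i \sum_j fold_block P i j * sqdist (mu i) (delta j)) <=
  \sum_k \sum_l P k l * sqdist (conj_closure mu k) (conj_closure delta l).
Proof.
move=> P0 mu0 delta0; rewrite mulr_sumr big_split_ord /= -big_split /=.
apply: ler_sum => i _; rewrite mulr_sumr !big_split_ord /= -!big_split /=.
apply: ler_sum => j _; rewrite !mxE mulrA mulrA divff ?pnatr_eq0 // mul1r.
rewrite !conj_closure_lshift !conj_closure_rshift sqdist_conj !mulrDl.
have [le1 le2] := sqdist_conj_le _ _ (mu0 i) (delta0 j).
by rewrite -!addrA lerD2l lerD ?ler_wpM2l // lerD2r ler_wpM2l.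
Qed.

End StandardSpectrum.

(** * The Hoffman-Wielandt inequality for quaternionic normal matrices *)

Theorem theorem3p1 (R : realType) (n : nat) (A B : 'M[quat R]_n)
    (mu delta : 'I_n -> R[i]) :
  normal_qmx A -> normal_qmx B ->
  standard_eigenvalues A mu -> standard_eigenvalues B delta ->
  exists p : 'S_n,
    \sum_(i < n) `|mu i - delta (p i)| ^+ 2 <= (frobenius (A - B) ^+ 2)%:C.
Proof.
move=> nA nB stdA stdB.
have [U Uu UE] := normalmx_diagonalization _ _ (normal_complex_adjoint _ nA)
  (standard_char_poly _ _ stdA).
have [V Vu VE] := normalmx_diagonalization _ _ (normal_complex_adjoint _ nB)
  (standard_char_poly _ _ stdB).
have := normal_distance _ _ _ _ _ _ Uu Vu UE VE.
set W := U *m _.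
have Wu : W \is unitarymx by rewrite mul_unitarymx // trmxC_unitary.
rewrite -complex_adjointB frobenius_complex_adjoint => distE.
(* [sqdist (W k l) 0] is the squared modulus of [W k l] as an element of [R]; unitarity of [W] makes
   these entries doubly stochastic. *)
pose P := \matrix_(k, l) sqdist (W k l) 0.
have PE k l : (P k l)%:C = `|W k l| ^+ 2 by rewrite mxE sqdistE subr0.
have dsP : doubly_stochastic P.
  split=> [k l|k|l].
  - by rewrite mxE addr_ge0 ?sqr_ge0.
  - apply: complexI; rewrite rmorph_sum /= -[RHS](unitarymx_row_sum W k Wu).
    by apply: eq_bigr.
  - apply: complexI; rewrite rmorph_sum /= -[RHS](unitarymx_col_sum W l Wu).
    by apply: eq_bigr.
pose c := \matrix_(i, j) sqdist (mu i) (delta j).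
have [p cp] := doubly_stochastic_assignment _ c (doubly_stochastic_fold _ dsP).
exists p.
have -> : \sum_i `|mu i - delta (p i)| ^+ 2 = (\sum_i c i (p i))%:C.
  by rewrite rmorph_sum; apply: eq_bigr => i _; rewrite /= mxE sqdistE.
rewrite lecR; apply: le_trans cp _.
(* Both sides are doubled because the complex adjoint doubles the squared Frobenius norm. *)
rewrite -(ler_pM2l (_ : 0 < 2)) // [leRHS]mulr_natl.
have -> : frobenius (A - B) ^+ 2 *+ 2 = \sum_k \sum_l
    P k l * sqdist (conj_closure mu k) (conj_closure delta l).
  apply: complexI; rewrite distE rmorph_sum; apply: eq_bigr => k _.
  rewrite rmorph_sum; apply: eq_bigr => l _.
  by rewrite rmorphM /= PE sqdistE.
have [[P0 _ _] [mu0 _]] := (dsP, stdA); have [delta0 _] := stdB.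
apply: le_trans (fold_block_cost _ _ _ P0 mu0 delta0).
rewrite ler_pM2l //; apply: ler_sum => i _; apply: ler_sum => j _.
by rewrite [c i j]mxE.
Qed.
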